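(* Let $\Lambda'\subset\mathbb{P}^n$ be a generic configuration of linear spaces, and let $\Gamma\subset\mathbb{P}^n$ be a generic $k$-dimensional linear space. Construct the configuration $\Lambda=\Lambda'\cup\Gamma$ and let $L=(l_0,\ldots,l_{n-2})$ be its weight vector. If, for an integer $d$, the following Hilbert function equality holds \[H(\Lambda,d)=H(\Lambda',d)+\binom{d+k}{k},\] and moreover \[\sum_{i=0}^{n-2}l_i(i+1)-1>dn,\] then $L$ is non-feasible.
   Context: Work over $\mathbb{C}$, with $n\ge 2$. A weight vector in $\mathbb{P}^n$ is a vector of non-negative integers $L=(l_0,\ldots,l_{n-2})$. A configuration of linear spaces of weight $L$ is a union $\Lambda_L\subset\mathbb{P}^n$ of $l_i$ linear spaces of dimension $i$, for $i=0,\ldots,n-2$; it is generic if the tuple of its linear components is chosen in a suitable non-empty Zariski open subset of the corresponding product of Grassmannians. So here $0\le k\le n-2$. A configuration $\Lambda_1\cup\dots\cup\Lambda_t$ is feasible if there is a rational normal curve $\mathcal{C}\subset\mathbb{P}^n$ (a curve projectively equivalent to the degree $n$ Veronese embedding of $\mathbb{P}^1$) such that the scheme $\mathcal{C}\cap\Lambda_i$ has degree $\dim\Lambda_i+1$ for every component $\Lambda_i$. The weight vector $L$ is feasible if a generic configuration of weight $L$ is feasible, and non-feasible otherwise. For a subscheme $X\subset\mathbb{P}^n$ with homogeneous ideal $I_X$ in $R=\mathbb{C}[x_0,\dots,x_n]$, $H(X,d)=\dim_{\mathbb{C}}(R/I_X)_d$ is its Hilbert function.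
   Formalization: The integer d is taken non-negative, and d = 0 is excluded when Λ' is empty; in those cases the claim as written fails (e.g. a single line in P^3 with d = 0 or d = -1 meets both conditions but is feasible). *)

(* Defs.v *)
From HB Require Import structures.
From mathcomp Require Import all_boot all_order all_algebra.
From mathcomp Require Import boolp classical_sets reals.
From mathcomp Require Import complex.
From mathcomp Require Import mpoly.

Set Implicit Arguments.
Unset Strict Implicit.
Unset Printing Implicit Defensive.

Import GRing.Theory.

Local Open Scope ring_scope.
Local Open Scope classical_set_scope.

Section HilbertFunction.
Context (F : fieldType) (n : nat).

(* A subset of P^n is given by the set of all homogeneous coordinate vectors
   of its points: a set of nonzero vectors of F^(n+1) stable under scaling. *)

Definition coords (v : 'rV[F]_n.+1) : 'I_n.+1 -> F := fun i => v 0 i.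

(* [pihomog mdeg d f] is the component of degree d of f. The ideal of the
   empty set is the whole ring. *)
Definition homogeneous_ideal (X : set 'rV[F]_n.+1) : set {mpoly F[n.+1]} :=
  [set f | forall d v, X v -> (pihomog mdeg d f).@[coords v] = 0].

Definition ideal_sum (I J : set {mpoly F[n.+1]}) : set {mpoly F[n.+1]} :=
  [set f | exists g h, [/\ I g, J h & f = g + h]].

(* The default value of xget is never used when I is an ideal, since its forms
   of degree d then make up a subspace of the finite dimensional space of all
   forms of degree d. *)
Definition degree_part (I : set {mpoly F[n.+1]}) (d : nat) :
    {vspace dhomog n.+1 F d} :=
  xget 0%VS [set U : {vspace dhomog n.+1 F d} |
              forall p : dhomog n.+1 F d,
                p \in U <-> I (mpoly_of_dhomog p)].

Definition hilbert_ideal (I : set {mpoly F[n.+1]}) (d : nat) : nat :=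
  (\dim {: dhomog n.+1 F d} - \dim (degree_part I d))%N.

Definition hilbert (X : set 'rV[F]_n.+1) (d : nat) : nat :=
  hilbert_ideal (homogeneous_ideal X) d.

(* The subscheme of P^n cut out by I, a homogeneous ideal that need not be
   saturated, is finite of degree r (empty if r = 0): its Hilbert polynomial
   is the constant r. *)
Definition has_finite_degree (I : set {mpoly F[n.+1]}) (r : nat) : Prop :=
  exists d0 : nat, forall d, (d0 <= d)%N -> hilbert_ideal I d = r.

End HilbertFunction.

Section Configurations.
Context (F : fieldType) (n : nat).

(* The Grassmannian of the linear spaces of (projective) dimension i in P^n. *)
Definition grassmannian (i : nat) :=
  {W : {vspace 'rV[F]_n.+1} | \dim W == i.+1}.

Definition linear_space (i : nat) (W : grassmannian i) : set 'rV[F]_n.+1 :=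
  [set v | v != 0 /\ v \in val W].

Section Product.
Context (I : finType) (e : I -> nat).

Definition grassmannian_product := forall x : I, grassmannian (e x).

Definition configuration_union (A : grassmannian_product) :
    set 'rV[F]_n.+1 :=
  [set v | exists x, linear_space (A x) v].

Definition entry := {x : I & ('I_(e x).+1 * 'I_n.+1)%type}.

Definition entries (M : forall x, 'M[F]_((e x).+1, n.+1)) :
    'I_#|{: entry}| -> F :=
  fun j => let y := enum_val j in M (tag y) (tagged y).1 (tagged y).2.

Definition row_space (m : nat) (M : 'M[F]_(m, n.+1)) : {vspace 'rV[F]_n.+1} :=
  <<[seq row i M | i : 'I_m]>>%VS.

(* The Zariski topology of a product of Grassmannians, as the quotient of that
   of the space of tuples of full rank matrices, by passage to row spaces
   (the equality of row spaces forces each M x to have full rank). *)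
Definition zariski_open (U : set grassmannian_product) : Prop :=
  exists S : set {mpoly F[#|{: entry}|]},
    forall (M : forall x, 'M[F]_((e x).+1, n.+1)) (A : grassmannian_product),
      (forall x, row_space (M x) = val (A x)) ->
      (U A <-> exists2 q, S q & q.@[entries M] != 0).

Definition holds_generically (P : set grassmannian_product) : Prop :=
  exists U, [/\ zariski_open U, U !=set0 & U `<=` P].

End Product.

(* The point (s^n : s^(n-1) t : ... : t^n). *)
Definition veronese (s t : F) : 'rV[F]_n.+1 :=
  \row_(i < n.+1) (s ^+ (n - i) * t ^+ i).

Definition rational_normal_curve (C : set 'rV[F]_n.+1) : Prop :=
  exists2 A : 'M[F]_n.+1, A \in unitmx &
    C = [set v | exists c s t, [/\ c != 0, (s, t) != (0, 0) &
                                   v = c *: (veronese s t *m A)]].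

Definition feasible_configuration (I : finType) (e : I -> nat)
    (A : grassmannian_product e) : Prop :=
  exists2 C, rational_normal_curve C &
    forall x, has_finite_degree
      (ideal_sum (homogeneous_ideal C)
                 (homogeneous_ideal (linear_space (A x))))
      (e x).+1.

(* For n >= 2, the index i : 'I_n.-1 ranges over 0, ..., n-2. *)
Definition weight := 'I_n.-1 -> nat.

(* Components of a configuration of weight L: the L i components of dimension
   i are indexed by the pairs (i, j) with j < L i. *)
Definition component (L : weight) := {i : 'I_n.-1 & 'I_(L i)}.

Definition component_dim (L : weight) (x : component L) : nat := tag x.

Definition feasible (L : weight) : Prop :=
  holds_generically (@feasible_configuration _ (@component_dim L)).

(* The dimensions of the members of a family made of a configuration of
   weight L (the indices Some x) and of one k-dimensional space (None). *)
Definition dims_with (L : weight) (k : nat) (o : option (component L)) : nat :=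
  if o is Some x then component_dim x else k.

Definition add_component (L : weight) (k : 'I_n.-1) : weight :=
  fun i => (L i + (i == k))%N.

End Configurations.

(* Main.v *)
(* Suppose L is feasible, and let A be a feasible configuration at which the
   Hilbert function of the components other than Gamma takes its generic
   values. The Hilbert function equality says that every form of degree d on
   Gamma is the restriction of a form of degree d vanishing on the other
   components. If the components met the rational normal curve C in distinct
   points, one could choose such a form to vanish at all the points of Gamma
   on C but one: it would have at least dn + 1 zeros on C, hence contain C,
   although it does not vanish at the last point.

   The intersections with C need not be reduced, nor disjoint. But a space
   of dimension i meeting C in degree i + 1 is the span of a divisor on C:
   the linear forms vanishing on it restrict to the multiples of a binary
   form of degree i + 1. Moving the roots of these binary forms moves A
   inside a curve of configurations whose general member has distinct points
   on C. Along it the Hilbert function of all components does not drop, by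
   semicontinuity, and that of the components other than Gamma is constant,
   so the argument applies to the general member. *)
Require Import Defs.
From HB Require Import structures.
From mathcomp Require Import all_boot all_order all_algebra.
From mathcomp Require Import boolp classical_sets reals.
From mathcomp Require Import complex.
From mathcomp Require Import mpoly.
From mathcomp Require Import zify.

Set Implicit Arguments.
Unset Strict Implicit.
Unset Printing Implicit Defensive.

Import GRing.Theory Num.Theory.

Local Open Scope ring_scope.
Local Open Scope classical_set_scope.

(** * Non-roots of polynomials, and subspaces given by a closed predicate *)

(** The first [size p] natural numbers are distinct in [K], too many to be all roots. *)
Lemma exists_nonroot (K : numDomainType) (p : {poly K}) :
  p != 0 -> exists x, p.[x] != 0.
Proof.
move=> p0; apply: contrapT => noroot.
pose s := [seq i%:R | i <- iota 0 (size p)] : seq K.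
have roots_s : all (root p) s.
  apply/allP => x _; apply/negP => /negP nx; apply: noroot; exists x.
  by rewrite -rootE.
have uniq_s : uniq s.
  rewrite map_inj_uniq ?iota_uniq // => i j /eqP.
  by rewrite eqr_nat => /eqP.
by have := max_poly_roots p0 roots_s uniq_s; rewrite size_map size_iota ltnn.
Qed.

(** A subspace of maximal dimension among those contained in [P] absorbs every vector of [P], since
    adding its line stays inside [P]. *)
Lemma vspace_of_closed (F : fieldType) (V : vectType F) (P : V -> Prop) :
  P 0 -> (forall a u v, P u -> P v -> P (a *: u + v)) ->
  exists U : {vspace V}, forall v, v \in U <-> P v.
Proof.
move=> P0 PD.
pose Q m := `[< exists U : {vspace V}, \dim U = m /\ {in U, forall v, P v} >].
have exQ : exists m, Q m.
  exists 0%N; apply/asboolP; exists 0%VS; split; first exact: dimv0.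
  by move=> v; rewrite memv0 => /eqP ->.
have ubQ m : Q m -> (m <= \dim {: V})%N.
  by move=> /asboolP[U [<- _]]; apply: dimvS; apply: subvf.
case: (ex_maxnP exQ ubQ) => m /asboolP[U [dimU PU]] maxm.
exists U => v; split=> [/PU //|Pv].
have : Q (\dim (<[v]> + U)%VS).
  apply/asboolP; exists (<[v]> + U)%VS; split => // w.
  by case/memv_addP => _ /vlineP[a ->] [u uU ->]; apply: PD => //; apply: PU.
move=> /maxm; rewrite -dimU => le_dim.
have /eqP -> : U == (<[v]> + U)%VS by rewrite eqEdim addvSr le_dim.
by rewrite memvE addvSl.
Qed.

(** * Substitution of polynomials in one variable into forms *)

Section Substitution.
Variables (F : fieldType) (N : nat).
Implicit Types (f : {mpoly F[N]}) (g : 'I_N -> {poly F}).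

Lemma horner_mmap g f x : (mmap polyC g f).[x] = f.@[fun i => (g i).[x]].
Proof.
rewrite /mmap horner_sum mevalE; apply: eq_bigr => m _.
rewrite hornerM hornerC; congr (_ * _); rewrite /mmap1 horner_prod.
by apply: eq_bigr => i _; rewrite horner_exp.
Qed.

Lemma meval_homog d f (c : F) (v : 'I_N -> F) :
  f \is d.-homog -> f.@[fun i => c * v i] = c ^+ d * f.@[v].
Proof.
move=> /dhomogP hf; rewrite !mevalE mulr_sumr big_seq [RHS]big_seq.
apply: eq_bigr => m /hf dm.
under eq_bigr do rewrite exprMn.
by rewrite big_split /= prodrXr -mdegE dm mulrCA.
Qed.

Lemma size_mmap_homog d f g n :
  f \is d.-homog -> (forall i, (size (g i) <= n.+1)%N) ->
  (size (mmap polyC g f) <= (d * n).+1)%N.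
Proof.
move=> /dhomogP hf sg; rewrite /mmap big_seq.
apply: (leq_trans (size_sum _ _ _)); apply/bigmax_leqP_seq => m _ /hf dm.
rewrite mul_polyC; apply: (leq_trans (size_scale_leq _ _)).
have {dm} : mdeg m = d := dm; rewrite mdegE => <-; rewrite /mmap1.
elim/big_rec2: _ => [|i D p _ IH].
  by rewrite size_poly1.
have sX : (size (g i ^+ m i) <= (m i * n).+1)%N.
  apply: (leq_trans (size_poly_exp_leq _ _)); rewrite ltnS mulnC leq_mul //.
  by case: (size (g i)) (sg i).
apply: (leq_trans (size_polyMleq _ _)).
rewrite mulnDl -subn1 leq_subLR add1n -addnS -addSn.
by apply: leq_add.
Qed.

End Substitution.

(** * Matrices depending polynomially on a parameter *)

Section Kernels.
Variable F : fieldType.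

Definition mx_at (r s : nat) (x : F) (T : 'M[{poly F}]_(r, s)) :=
  map_mx (horner_eval x) T.

(* If T(0) B = 1, then det(T B) y - B adj(T B) T y is killed by T and takes
   the value y at 0. *)
Lemma kernel_path (r N s : nat) (T : 'M[{poly F}]_(r, N)) (y : 'M[F]_(N, s)) :
  row_free (mx_at 0 T) -> mx_at 0 T *m y = 0 ->
  exists2 Y : 'M[{poly F}]_(N, s), T *m Y = 0 & mx_at 0 Y = y.
Proof.
move=> /row_freeP[B TB] Ty.
pose B' := map_mx polyC B; pose y' := map_mx polyC y.
have B'0 : mx_at 0 B' = B.
  by apply/matrixP => i j; rewrite !mxE /horner_eval hornerC.
have y'0 : mx_at 0 y' = y.
  by apply/matrixP => i j; rewrite !mxE /horner_eval hornerC.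
pose D := T *m B'.
have D0 : mx_at 0 D = 1%:M by rewrite /mx_at map_mxM [map_mx _ B']B'0.
exists (\det D *: y' - B' *m \adj D *m (T *m y')).
  rewrite mulmxBr -scalemxAr !mulmxA -/D mul_mx_adj mul_scalar_mx.
  by rewrite -scalemxAl subrr.
rewrite /mx_at map_mxB map_mxZ -det_map_mx [map_mx _ D]D0 det1.
rewrite !map_mxM [map_mx _ y']y'0 Ty mulmx0 subr0.
by rewrite scale1r.
Qed.

(** For a right inverse [B] of T(0), the determinant of T B is 1 at 0, and T(x) has full rank
    wherever it is nonzero. *)
Lemma row_free_path (r N : nat) (T : 'M[{poly F}]_(r, N)) :
  row_free (mx_at 0 T) ->
  exists2 p : {poly F}, p.[0] != 0 & forall x, p.[x] != 0 -> row_free (mx_at x T).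
Proof.
move=> /row_freeP[B TB]; exists (\det (T *m map_mx polyC B)) => [|x].
all: rewrite -[X in X != 0]/(horner_eval _ _) -det_map_mx map_mxM.
all: rewrite -[map_mx _ (map_mx _ _)]map_mx_comp.
all: rewrite (_ : map_mx _ B = B); last first.
all: try by apply/matrixP => i j; rewrite !mxE /= /horner_eval hornerC.
  by rewrite [map_mx _ _ *m _]TB det1 oner_neq0.
rewrite -unitfE -[_ \is a _]unitmxE => U; apply/row_freeP.
by exists (B *m invmx (mx_at x T *m B)); rewrite mulmxA mulmxV.
Qed.

End Kernels.

(** * Growth of spaces of polynomials under multiplication by X *)

Section MultiplicationByX.
Variables (F : fieldType) (N : nat).
Implicit Types (U : {vspace 'rV[F]_N}) (u : 'rV[F]_N).

(** Vectors of length [N] stand for polynomials of degree less than [N]. The product is truncated by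
    [poly_rV], hence the bounds on [size] below. *)
Definition mulX : 'End('rV[F]_N) := linfun (poly_rV \o ('X \*o @rVpoly F N)).

Lemma rVpoly_mulX u :
  (size (rVpoly u) < N)%N -> rVpoly (mulX u) = 'X * rVpoly u.
Proof.
move=> su; rewrite lfunE /= poly_rV_K //.
by apply: (leq_trans (size_polyMleq _ _)); rewrite size_polyX.
Qed.

(** If the dimension did not grow, [U] would be stable under multiplication by X and contain
    polynomials of unbounded degree. *)
Lemma dim_mulX_lt U : U != 0%VS -> {in U, forall u, (size (rVpoly u) < N)%N} ->
  (\dim U < \dim (U + mulX @: U))%N.
Proof.
move=> U0 sU; rewrite ltnNge; apply/negP => dimle.
have {dimle} defU : (U + mulX @: U)%VS = U.
  by apply/eqP; rewrite eq_sym eqEdim addvSl dimle.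
have step u : u \in U -> mulX u \in U.
  by move=> uU; rewrite -defU (subvP (addvSr _ _)) ?memv_img.
have [v vU v0] : exists2 v, v \in U & v != 0.
  exists (vpick U); first exact: memv_pick.
  by rewrite vpick0.
suff /(_ N)[u uU] : forall j, exists2 u, u \in U & (j < size (rVpoly u))%N.
  by move=> lt_N; have := ltn_trans lt_N (sU u uU); rewrite ltnn.
elim=> [|j [u uU ju]].
  exists v => //; rewrite size_poly_gt0; apply: contra v0 => /eqP v0.
  by rewrite -(rVpolyK v) v0 linear0.
exists (mulX u); first exact: step.
rewrite rVpoly_mulX ?sU // mulrC size_mulX // -size_poly_gt0.
exact: leq_ltn_trans ju.
Qed.

Lemma mulX_inj U : {in U, forall u, (size (rVpoly u) < N)%N} ->
  (U :&: lker mulX)%VS = 0%VS.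
Proof.
move=> sU; apply/eqP; rewrite -subv0; apply/subvP => u.
rewrite memv_cap memv_ker memv0 => /andP[uU /eqP Xu].
have /eqP : 'X * rVpoly u = 0 by rewrite -rVpoly_mulX ?sU // Xu linear0.
rewrite mulf_eq0 polyX_eq0 /= => /eqP u0.
by rewrite -(rVpolyK u) u0 linear0.
Qed.

(* The case of equality in [dim_mulX_lt]: the subspace of those u in U for
   which X u is also in U inherits the hypothesis. *)
Lemma dim_mulX_eq (v : nat) U : {in U, forall u, (size (rVpoly u) < N)%N} ->
  (0 < v <= \dim U)%N -> (\dim (U + mulX @: U) <= (\dim U).+1)%N ->
  exists2 G : {poly F}, G != 0 &
    forall b, (b < v)%N -> exists2 u, u \in U & rVpoly u = G * 'X^b.
Proof.
elim: v U => // v IH U sU /andP[_ ltvU] dimU.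
case: (posnP v) => [->|v_gt0].
  exists (rVpoly (vpick U)).
    apply/eqP => p0; have := leq_trans (ltn0Sn v) ltvU; rewrite lt0n dimv_eq0 -vpick0.
    by rewrite -(rVpolyK (vpick U)) p0 linear0 eqxx.
  by case=> // _; exists (vpick U); rewrite ?memv_pick // expr0 mulr1.
pose U1 := (U :&: mulX @^-1: U)%VS.
have U1U : (U1 <= U)%VS by apply: capvSl.
have XU1 : (mulX @: U1 <= U)%VS.
  apply/subvP => _ /memv_imgP[u /memv_capP[_ uX] ->].
  by rewrite memv_preim.
have dimXU : \dim (mulX @: U) = \dim U by apply/limg_dim_eq/mulX_inj.
(* The intersection of [U] and X [U] lies in X [U1], so [U1] has codimension at most one in [U]. *)
have dimU1 : (\dim U <= (\dim U1).+1)%N.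
  have le1 : (\dim (U :&: mulX @: U) <= \dim U1)%N.
    have <- : \dim (mulX @: U1) = \dim U1.
      apply/limg_dim_eq/mulX_inj => u /(subvP U1U); exact: sU.
    apply: dimvS; apply/subvP => w /memv_capP[wU /memv_imgP[u uU def_w]].
    rewrite def_w memv_img // memv_cap uU /= -memv_preim -def_w //.
  have := dimv_sum_cap U (mulX @: U); rewrite dimXU => dimsum.
  rewrite -(leq_add2l (\dim U)) -dimsum addnS -addSn.
  exact: leq_add.
have [||| G G0 HG] := IH U1.
- by move=> u /(subvP U1U); apply: sU.
- by rewrite v_gt0 /= -ltnS (leq_trans ltvU).
- apply: leq_trans dimU1; apply: dimvS; rewrite subv_add U1U; exact: XU1.
exists G => // b; rewrite ltnS leq_eqVlt => /orP[/eqP ->|/HG[u uU1 Gu]].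
  (* The one new exponent is reached from the last element found in [U1], since X [U1] lies in
     [U]. *)
  case: v v_gt0 HG {IH ltvU} => // v _ HG; have [//|u uU1 Gu] := HG v.
  exists (mulX u); first by apply: (subvP XU1); apply: memv_img.
  by rewrite rVpoly_mulX ?sU ?(subvP U1U) // Gu mulrCA -exprS.
by exists u => //; apply: (subvP U1U).
Qed.

End MultiplicationByX.

(** * Linear spaces as row spaces *)

Section RowSpaces.
Variables (F : fieldType) (n : nat).

Lemma row_space_limg (m : nat) (M : 'M[F]_(m, n.+1)) :
  row_space M = limg (linfun (mulmxr M) : 'Hom('rV[F]_m, 'rV[F]_n.+1)).
Proof.
apply/eqP; rewrite eqEsubv; apply/andP; split.
  apply/span_subvP => _ /mapP[i _ ->]; rewrite rowE.
  by apply/memv_imgP; exists (delta_mx 0 i); rewrite ?memvf ?lfunE.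
apply/subvP => _ /memv_imgP[c _ ->]; rewrite lfunE /= mulmx_sum_row.
rewrite memv_suml // => i _; rewrite memvZ // memv_span //.
by apply: map_f; rewrite mem_enum.
Qed.

Lemma row_spaceP (m : nat) (M : 'M[F]_(m, n.+1)) v :
  reflect (exists c, v = c *m M) (v \in row_space M).
Proof.
rewrite row_space_limg; apply: (iffP memv_imgP) => [[c _ ->]|[c ->]].
  by exists c; rewrite lfunE.
by exists c; rewrite ?memvf // lfunE.
Qed.

Lemma dim_row_space (m : nat) (M : 'M[F]_(m, n.+1)) :
  (\dim (row_space M) == m) = row_free M.
Proof.
pose f : 'Hom('rV[F]_m, 'rV[F]_n.+1) := linfun (mulmxr M).
have dimE : (\dim (lker f) + \dim (limg f))%N = m.
  have := limg_ker_dim f fullv; rewrite capfv => ->.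
  by rewrite dimvf /dim /= mul1n.
rewrite row_space_limg -/f -[X in _ == X]dimE -[X in X == _]add0n eqn_add2r.
rewrite eq_sym dimv_eq0; apply/idP/idP => [/eqP ker0|freeM].
  apply: inj_row_free => v vM; apply/eqP.
  by rewrite -memv0 -ker0 memv_ker lfunE /= vM.
apply/eqP/vspaceP => v; rewrite memv_ker memv0 lfunE /=.
by rewrite -(inj_eq (row_free_inj freeM)) mul0mx.
Qed.

Lemma row_space_exists (i : nat) (W : {vspace 'rV[F]_n.+1}) :
  \dim W = i -> exists M : 'M[F]_(i, n.+1), row_space M = W.
Proof.
move=> <-; exists (\matrix_j (vbasis W)`_j).
rewrite -[RHS](span_basis (vbasisP W)); congr (span _).
apply: (@eq_from_nth _ 0); rewrite size_map size_enum_ord ?size_tuple // => j lt_j.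
by rewrite (nth_map (Ordinal lt_j)) ?size_enum_ord // rowK nth_enum_ord.
Qed.

End RowSpaces.

(** * Vanishing forms and Hilbert functions in a fixed degree *)

Section DegreeParts.
Variables (F : fieldType) (n : nat).
Implicit Types (X : set 'rV[F]_n.+1) (I : set {mpoly F[n.+1]}) (d : nat).

Lemma mem_degree_part I d :
  I 0 -> (forall a p q, I p -> I q -> I (a *: p + q)) ->
  forall p : dhomog n.+1 F d, p \in degree_part I d <-> I (mpoly_of_dhomog p).
Proof.
move=> I0 ID; rewrite /degree_part.
have [U HU] : exists U : {vspace dhomog n.+1 F d},
    forall p, p \in U <-> I (mpoly_of_dhomog p).
  apply: vspace_of_closed; first by rewrite linear0.
  by move=> a u v; rewrite linearP /=; apply: ID.
pose P (W : {vspace dhomog n.+1 F d}) :=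
  forall p : dhomog n.+1 F d, p \in W <-> I (mpoly_of_dhomog p).
exact: (@xgetPex _ 0%VS [set W | P W] (ex_intro _ U HU)).
Qed.

Lemma homogeneous_ideal_closed X a p q : homogeneous_ideal X p ->
  homogeneous_ideal X q -> homogeneous_ideal X (a *: p + q).
Proof.
by move=> Ip Iq d v Xv; rewrite linearP /= mevalD mevalZ Ip // Iq // mulr0 addr0.
Qed.

Lemma homogeneous_ideal0 X : homogeneous_ideal X 0.
Proof. by move=> d v _; rewrite linear0 meval0. Qed.

Lemma homogeneous_idealE X d (p : {mpoly F[n.+1]}) : p \is d.-homog ->
  homogeneous_ideal X p <-> forall v, X v -> p.@[coords v] = 0.
Proof.
move=> hp; split=> [Ip v Xv|Ip e v Xv]; first by rewrite -(pihomog_dE hp) Ip.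
have [<-|ne] := eqVneq d e; first by rewrite pihomog_dE // Ip.
by rewrite (pihomog_ne0 ne hp) meval0.
Qed.

Definition vanishing X d := degree_part (homogeneous_ideal X) d.

Lemma mem_vanishing X d (p : dhomog n.+1 F d) :
  p \in vanishing X d <-> forall v, X v -> (mpoly_of_dhomog p).@[coords v] = 0.
Proof.
apply: iff_trans (homogeneous_idealE X (dhomog_is_dhomog p)).
apply: mem_degree_part; first exact: homogeneous_ideal0.
by move=> *; apply: homogeneous_ideal_closed.
Qed.

Lemma mem_ideal_sum X Y d (p : dhomog n.+1 F d) :
  p \in degree_part (ideal_sum (homogeneous_ideal X) (homogeneous_ideal Y)) d <->
  ideal_sum (homogeneous_ideal X) (homogeneous_ideal Y) p.
Proof.
apply: mem_degree_part => [|a q1 q2 [g1 [h1 [Ig1 Ih1 ->]]] [g2 [h2 [Ig2 Ih2 ->]]]].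
  by exists 0, 0; split; rewrite ?addr0 //; apply: homogeneous_ideal0.
exists (a *: g1 + g2), (a *: h1 + h2).
split; try exact: homogeneous_ideal_closed.
by rewrite scalerDr addrACA.
Qed.

Lemma dim_vanishing_hilbert X d :
  (\dim (vanishing X d) + hilbert X d)%N = \dim {: dhomog n.+1 F d}.
Proof. by rewrite /hilbert /hilbert_ideal subnKC // dimvS // subvf. Qed.

Lemma dim_dhomog m d : \dim {: dhomog m.+1 F d} = 'C(d + m, d).
Proof. by rewrite dimvf. Qed.

Lemma comp_dhomog m d (f : {mpoly F[n.+1]}) (g : n.+1.-tuple {mpoly F[m]}) :
  f \is d.-homog -> (forall i, tnth g i \is 1.-homog) -> f \mPo g \is d.-homog.
Proof.
move=> /dhomogP hf hg; rewrite comp_mpolyEX big_seq.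
apply: rpred_sum => mm /hf dm; apply: rpredZ; rewrite comp_mpolyX.
have {dm} : mdeg mm = d := dm; rewrite mdegE => <-.
elim/big_rec2: _ => [|i e p _ IH]; first exact: dhomog1.
by apply: dhomogM => //; rewrite -[X in X.-homog]mul1n; apply: dhomogMn.
Qed.

(** Substituting a parametrization of [W] sends forms of degree [d] to forms in k + 1 variables,
    which make up a space of dimension ['C(d + k, k)]. The forms in the kernel vanish on [W]. *)
Lemma dim_vanishing_linear d k (W : grassmannian F n k) :
  ('C(d + n, d) <= \dim (vanishing (linear_space W) d) + 'C(d + k, k))%N.
Proof.
have [M defW] := row_space_exists (eqP (valP W)).
pose g := [tuple \sum_a M a i *: 'X_a | i < n.+1] : n.+1.-tuple {mpoly F[k.+1]}.
have hg i : tnth g i \is 1.-homog.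
  rewrite tnth_mktuple; apply: rpred_sum => a _; apply: rpredZ.
  by rewrite dhomogX /= mdeg1.
pose r (p : dhomog n.+1 F d) : dhomog k.+1 F d :=
  DHomog (comp_dhomog (dhomog_is_dhomog p) hg).
have r_lin : linear r.
  by move=> a p q; apply: val_inj; rewrite /= comp_mpolyD comp_mpolyZ.
pose rL := GRing.isLinear.Build F _ _ _ r r_lin.
pose rl : {linear dhomog n.+1 F d -> dhomog k.+1 F d} := HB.pack r rL.
have := limg_ker_dim (linfun rl) fullv; rewrite capfv dim_dhomog => <-.
apply: leq_add; last first.
  by rewrite -bin_sub ?leq_addl // addnK -dim_dhomog dimvS // subvf.
apply: dimvS; apply/subvP => p; rewrite memv_ker lfunE /= => /eqP rp0.
apply/mem_vanishing => v [_]; rewrite -defW => /row_spaceP[c ->].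
have : (mpoly_of_dhomog (r p)).@[c 0] = 0 by rewrite rp0 /= meval0.
rewrite /= comp_mpoly_meval => p0; rewrite -[RHS]p0; apply: meval_eq => i.
rewrite tnth_mktuple raddf_sum /coords mxE; apply: eq_bigr => a _ /=.
by rewrite mevalZ mevalXU mulrC.
Qed.

(* The forms of degree d vanishing on X and on W make up the intersection of
   the two vanishing spaces, so the hypothesis forces their sum to be
   everything. *)
Lemma split_form X d k (W : grassmannian F n k) :
  (hilbert X d + 'C(d + k, k) <= hilbert (X `|` linear_space W) d)%N ->
  forall l : dhomog n.+1 F d,
    exists f g : dhomog n.+1 F d, [/\ f \in vanishing X d,
      g \in vanishing (linear_space W) d & l = f + g].
Proof.
move=> leH l.
have capE : (vanishing X d :&: vanishing (linear_space W) d)%VS =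
            vanishing (X `|` linear_space W) d.
  apply/vspaceP => p; rewrite memv_cap; apply/andP/idP => [[]|/mem_vanishing pV].
    move=> /mem_vanishing pX /mem_vanishing pW; apply/mem_vanishing => v [/pX|/pW] //.
  by split; apply/mem_vanishing => v Hv; apply: pV; [left | right].
have := dimv_sum_cap (vanishing X d) (vanishing (linear_space W) d).
rewrite capE => dimE.
have full : (vanishing X d + vanishing (linear_space W) d)%VS = fullv.
  apply/eqP; rewrite eqEdim subvf /=.
  have := dim_vanishing_linear d W; rewrite -dim_dhomog.
  have := dim_vanishing_hilbert X d.
  have := dim_vanishing_hilbert (X `|` linear_space W) d.
  lia.
have : l \in (vanishing X d + vanishing (linear_space W) d)%VS by rewrite full memvf.
by case/memv_addP => f fX [g gW ->]; exists f, g.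
Qed.

(** This makes a lower bound on the Hilbert function an open condition. A nonzero determinant makes
    the forms independent modulo those vanishing on [X]. Conversely, points and forms are added one
    by one, each new form vanishing at the earlier points but not at the new one, so that the matrix
    is block triangular. *)
Lemma hilbert_geP X d r : (r <= hilbert X d)%N <->
  exists (p : 'I_r -> 'rV[F]_n.+1) (f : 'I_r -> dhomog n.+1 F d),
    (forall b, X (p b)) /\
    \det (\matrix_(a, b) (mpoly_of_dhomog (f a)).@[coords (p b)]) != 0.
Proof.
split; last first.
  move=> [p [f [Xp det0]]]; set T := \matrix_(a, b) _ in det0.
  pose g (w : 'rV[F]_r) := \sum_a w 0 a *: f a.
  have g_lin : linear g.
    move=> c u w; rewrite /g scaler_sumr -big_split; apply: eq_bigr => a _ /=.
    by rewrite !mxE scalerDl scalerA.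
  pose gL := GRing.isLinear.Build F _ _ _ g g_lin.
  pose gl : {linear 'rV[F]_r -> dhomog n.+1 F d} := HB.pack g gL.
  have ginj w : g w \in vanishing X d -> w = 0.
    move=> /mem_vanishing gX; apply: (row_free_inj (A := T)).
      by rewrite row_free_unit unitmxE unitfE.
    rewrite mul0mx; apply/rowP => b; rewrite !mxE -[RHS](gX (p b) (Xp b)).
    rewrite /g !raddf_sum /=; apply: eq_bigr => a _.
    by rewrite mxE mevalZ.
  have ker0 : (fullv :&: lker (linfun gl))%VS = 0%VS.
    apply/eqP; rewrite -subv0; apply/subvP => w; rewrite memv_cap memv_ker lfunE.
    by move=> /andP[_ /eqP /= gw]; rewrite memv0 (ginj w) // gw mem0v.
  have cap0 : (limg (linfun gl) :&: vanishing X d)%VS = 0%VS.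
    apply/eqP; rewrite -subv0; apply/subvP => q; rewrite memv_cap.
    move=> /andP[/memv_imgP[w _ ->]]; rewrite lfunE /= => /ginj ->.
    by rewrite memv0 -[g 0]/(gl 0) linear0.
  have dimE := dimv_disjoint_sum cap0.
  have := dimvS (subvf (limg (linfun gl) + vanishing X d)); move: dimE.
  rewrite (limg_dim_eq ker0) [\dim {: 'rV_r}]dimvf [dim _]mul1n.
  (* [reverse_coercion] hides from lia that some of the dimensions coincide. *)
  by have := dim_vanishing_hilbert X d; rewrite /reverse_coercion; lia.
elim: r => [_|r IH lt_r].
  exists (fun _ => 0), (fun _ => 0); split; first by case.
  by rewrite det_mx00 oner_neq0.
have [p [f [Xp det0]]] := IH (ltnW lt_r).
pose ev (q : dhomog n.+1 F d) := \row_b (mpoly_of_dhomog q).@[coords (p b)].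
have ev_lin : linear ev.
  by move=> c u w; apply/rowP => b; rewrite !mxE /= mevalD mevalZ.
pose evL := GRing.isLinear.Build F _ _ _ ev ev_lin.
pose evl : {linear dhomog n.+1 F d -> 'rV[F]_r} := HB.pack ev evL.
have [q qp [v Xv qv]] : exists2 q : dhomog n.+1 F d,
    forall b, (mpoly_of_dhomog q).@[coords (p b)] = 0 &
    exists2 v, X v & (mpoly_of_dhomog q).@[coords v] != 0.
  (* The forms vanishing at the [r] points have codimension at most [r], less than that of the forms
     vanishing on [X]. *)
  apply: contrapT => noq.
  have : (\dim (lker (linfun evl)) <= \dim (vanishing X d))%N.
    apply: dimvS; apply/subvP => q; rewrite memv_ker lfunE /= => /eqP evq.
    apply/mem_vanishing => v Xv; apply: contrapT => /eqP qv; apply: noq.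
    exists q; last by exists v.
    by move=> b; move/rowP: evq => /(_ b); rewrite !mxE.
  have := limg_ker_dim (linfun evl) fullv; rewrite capfv.
  have := dimvS (subvf (limg (linfun evl))); rewrite [\dim {: 'rV_r}]dimvf [dim _]mul1n.
  by have := dim_vanishing_hilbert X d; rewrite /reverse_coercion; lia.
exists (fun b : 'I_(1 + r) => if split b is inr b' then p b' else v).
exists (fun b : 'I_(1 + r) => if split b is inr b' then f b' else q).
split; first by move=> b; case: split.
set Aul := \matrix_(a < 1, b < 1) (mpoly_of_dhomog q).@[coords v].
set Adr := \matrix_(a < r, b < r) _ in det0.
suff det_block : forall T : 'M[F]_(1 + r), T = block_mx Aul 0
    (\matrix_(a < r, b < 1) (mpoly_of_dhomog (f a)).@[coords v]) Adr ->
    \det T != 0.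
  apply: det_block.
  apply/matrixP => a b; rewrite !mxE; case: (split a) => a'; rewrite mxE.
    by case: (split b) => b'; rewrite mxE ?qp.
  by case: (split b) => b'; rewrite mxE.
by move=> _ ->; rewrite det_lblock mulf_neq0 // det_mx11 mxE.
Qed.

End DegreeParts.

(** * Zariski open sets and semicontinuity of the Hilbert function *)

Section ZariskiOpen.
Variables (F : fieldType) (n : nat) (I : finType) (e : I -> nat).
Implicit Types (U V : set (grassmannian_product F n e)).
Implicit Types (A : grassmannian_product F n e).

Definition represents (M : forall x, 'M[F]_((e x).+1, n.+1)) A :=
  forall x, row_space (M x) = val (A x).

Lemma represents_exists A : exists M, represents M A.
Proof.
by exists (fun x => projT1 (cid (row_space_exists (eqP (valP (A x)))))) => x;
  case: cid.
Qed.

Lemma zariski_openT : @zariski_open F n I e setT.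
Proof.
exists [set 1] => M A _; split=> // _.
by exists 1; rewrite ?meval1 ?oner_neq0.
Qed.

Lemma zariski_openI U V :
  zariski_open U -> zariski_open V -> zariski_open (U `&` V).
Proof.
move=> [S HS] [T HT].
exists [set q | exists q1 q2, [/\ S q1, T q2 & q = q1 * q2]] => M A MA.
split=> [[/(HS _ _ MA)[q1 Sq1 q1M] /(HT _ _ MA)[q2 Tq2 q2M]]|].
  by exists (q1 * q2); [exists q1, q2 | rewrite mevalM mulf_neq0].
move=> [q [q1 [q2 [Sq1 Tq2 ->]]]].
rewrite mevalM mulf_eq0 negb_or => /andP[q1M q2M].
by split; [apply/(HS _ _ MA); exists q1 | apply/(HT _ _ MA); exists q2].
Qed.

Lemma zariski_open_bigcap D (U : nat -> set (grassmannian_product F n e)) :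
  (forall d, zariski_open (U d)) ->
  zariski_open [set A | forall d, (d < D)%N -> U d A].
Proof.
move=> openU; elim: D => [|D IH].
  by rewrite (_ : [set _ | _] = setT) //; [exact: zariski_openT|apply/seteqP].
rewrite (_ : [set _ | _] = [set A | forall d, (d < D)%N -> U d A] `&` U D).
  exact: zariski_openI.
apply/seteqP; split=> A /= => [UA|[UA UDA] d].
  by split=> [d dD|]; apply: UA; rewrite // ltnW.
by rewrite ltnS leq_eqVlt => /orP[/eqP ->|/UA].
Qed.

(** A polynomial witnessing that [A] is in [U] pulls back along the path [M] to a polynomial in the
    parameter, nonzero at 0. *)
Lemma zariski_open_path U A (M : forall x, 'M[{poly F}]_((e x).+1, n.+1)) :
  zariski_open U -> U A -> represents (fun x => mx_at 0 (M x)) A ->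
  exists2 p : {poly F}, p.[0] != 0 & forall t, p.[t] != 0 ->
    forall B, represents (fun x => mx_at t (M x)) B -> U B.
Proof.
move=> [S HS] UA MA; have /(HS _ _ MA)[q Sq q0] := UA.
pose g (j : 'I_#|{: entry n e}|) :=
  let y := enum_val j in M (tag y) (tagged y).1 (tagged y).2.
have evalE t : (mmap polyC g q).[t] = q.@[entries (fun x => mx_at t (M x))].
  by rewrite horner_mmap; apply: meval_eq => j; rewrite /entries /= mxE.
exists (mmap polyC g q) => [|t qt B MB]; first by rewrite evalE.
by apply/(HS _ _ MB); exists q => //; rewrite -evalE.
Qed.

(** The predicate [Q] allows one treatment of all components and of all but one. *)
Definition union_on (Q : I -> Prop) A : set 'rV[F]_n.+1 :=
  [set v | exists x, Q x /\ linear_space (A x) v].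

(* The condition is the nonvanishing of some determinant of values of forms at
   points of the union; such points have the form [c *m M x]. *)
Lemma hilbert_open (Q : I -> Prop) d r :
  zariski_open [set A | (r <= hilbert (union_on Q A) d.+1)%N].
Proof.
pose point := {x : I & 'rV[F]_(e x).+1}.
pose var (x : I) (j : 'I_(e x).+1) (i : 'I_n.+1) : 'I_#|{: entry n e}| :=
  enum_rank (Tagged (fun x : I => 'I_(e x).+1 * 'I_n.+1)%type (j, i)).
pose gen (y : point) := [tuple \sum_j tagged y 0 j *: 'X_(var (tag y) j i)
                         | i < n.+1] : n.+1.-tuple {mpoly F[#|{: entry n e}|]}.
have genE M (y : point) (f : {mpoly F[n.+1]}) :
    (f \mPo gen y).@[entries M] = f.@[coords (tagged y *m M (tag y))].
  rewrite comp_mpoly_meval; apply: meval_eq => i.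
  rewrite tnth_mktuple raddf_sum /coords mxE; apply: eq_bigr => j _ /=.
  by rewrite mevalZ mevalXU /entries enum_rankK.
exists [set q | exists (y : 'I_r -> point) (f : 'I_r -> dhomog n.+1 F d.+1),
   (forall b, Q (tag (y b))) /\
   q = \det (\matrix_(a, b) (mpoly_of_dhomog (f a) \mPo gen (y b)))] => M A MA.
have detE (y : 'I_r -> point) (f : 'I_r -> dhomog n.+1 F d.+1) :
  (\det (\matrix_(a, b) (mpoly_of_dhomog (f a) \mPo gen (y b)))).@[entries M] =
  \det (\matrix_(a, b) (mpoly_of_dhomog (f a)).@[coords (tagged (y b) *m M (tag (y b)))]).
  rewrite -det_map_mx; congr (\det _); apply/matrixP => a b.
  by rewrite !mxE /= genE.
split=> [/hilbert_geP[p [f [Ap det0]]]|[q [y [f [Qy ->]]]]].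
  have /choice[y yP] b : exists y : point,
      Q (tag y) /\ p b = tagged y *m M (tag y).
    have [x [Qx [_]]] := Ap b; rewrite -MA => /row_spaceP[c pc].
    by exists (Tagged (fun x : I => 'rV[F]_(e x).+1) c).
  exists (\det (\matrix_(a, b) (mpoly_of_dhomog (f a) \mPo gen (y b)))).
    by exists y, f; split=> // b; case: (yP b).
  rewrite detE; congr (\det _ != 0): det0; apply/matrixP => a b.
  by rewrite !mxE; case: (yP b) => _ <-.
rewrite detE => det0; apply/hilbert_geP.
exists (fun b => tagged (y b) *m M (tag (y b))), f; split=> // b.
exists (tag (y b)); split=> //; split; last first.
  by rewrite -MA; apply/row_spaceP; exists (tagged (y b)).
(* A zero vector is not a point of the union. It would give a zero column, as the degree [d.+1] is
   positive. *)
apply: contra det0 => /eqP pb0; rewrite (expand_det_col _ b) big1 // => a _.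
rewrite mxE pb0 (@meval_eq _ _ _ (fun i => 0 * 0)) => [|i]; last first.
  by rewrite /coords mxE mulr0.
by rewrite (meval_homog _ _ (dhomog_is_dhomog (f a))) exprS !mul0r.
Qed.

End ZariskiOpen.

(** * Change of the index type of a configuration *)

Section Transfer.
Variables (F : fieldType) (n : nat) (I J : finType) (e : I -> nat) (e' : J -> nat).
Variables (phi : I -> J) (psi : J -> I).
Hypotheses (phiK : cancel phi psi) (psiK : cancel psi phi).
Hypothesis eE : forall x, e x = e' (phi x).

(** Underlying subspaces are compared because [e x] and [e' (phi x)] are not convertible. *)
Definition same_spaces (A : grassmannian_product F n e)
    (B : grassmannian_product F n e') := forall x, val (A x) = val (B (phi x)).

(** The equations are carried over by renaming their variables, which are the matrix entries. *)
Lemma reindex_holds_generically (P : set (grassmannian_product F n e'))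
    (P' : set (grassmannian_product F n e)) :
  (forall A B, same_spaces A B -> P B -> P' A) ->
  holds_generically P -> holds_generically P'.
Proof.
move=> PP' [U [[S HS] [B UB] UP]].
have eE' y : (e' y).+1 = (e (psi y)).+1 by rewrite eE psiK.
exists [set A | exists2 B, same_spaces A B & U B]; split; last first.
- by move=> A [B' AB' /UP]; apply: PP'.
- have dimB x : \dim (val (B (phi x))) == (e x).+1 by rewrite eE; exact: valP (B (phi x)).
  exists (fun x => exist _ (val (B (phi x))) (dimB x)).
  by exists B.
pose ren (j : 'I_#|{: entry n e'}|) : 'I_#|{: entry n e}| :=
  let y := enum_val j in enum_rank (Tagged (fun x => 'I_(e x).+1 * 'I_n.+1)%type
     (cast_ord (eE' (tag y)) (tagged y).1, (tagged y).2)).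
pose rename (q : {mpoly F[_]}) :=
  q \mPo [tuple 'X_(ren j) : {mpoly F[_]} | j < #|{: entry n e'}|].
exists [set q | exists2 q', S q' & q = rename q'].
move=> M A MA.
pose M' y := \matrix_(a < (e' y).+1, i < n.+1) M (psi y) (cast_ord (eE' y) a) i.
have renE q : (rename q).@[entries M] = q.@[entries M'].
  rewrite comp_mpoly_meval; apply: meval_eq => j.
  by rewrite tnth_mktuple mevalXU /entries enum_rankK /= mxE.
have M'E y : row_space (M' y) = val (A (psi y)).
  rewrite -MA; apply: eq_span => v; apply/mapP/mapP => -[a _ ->].
    exists (cast_ord (eE' y) a); first by rewrite mem_enum.
    by apply/rowP => i; rewrite !mxE.
  exists (cast_ord (esym (eE' y)) a); first by rewrite mem_enum.
  by apply/rowP => i; rewrite !mxE cast_ordKV.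
split=> [[B' AB' UB']|[q [q' Sq' ->]]].
  have /HS/iffLR/(_ UB')[q Sq qB] : forall y, row_space (M' y) = val (B' y).
    by move=> y; rewrite M'E AB' psiK.
  by exists (rename q); rewrite ?renE //; exists q.
rewrite renE => q'M.
have dimA y : \dim (val (A (psi y))) == (e' y).+1.
  by rewrite eE'; exact: valP (A (psi y)).
pose B' y : grassmannian F n (e' y) := exist _ (val (A (psi y))) (dimA y).
exists B'; first by move=> x; rewrite /= phiK.
by apply/(HS M' B' M'E); exists q'.
Qed.

End Transfer.

(** * Restriction of forms to a rational normal curve *)

Section RationalNormalCurve.
Variables (F : numFieldType) (n : nat) (B : 'M[F]_n.+1).
Hypothesis B_unit : B \in unitmx.

Definition rnc : set 'rV[F]_n.+1 :=
  [set v | exists c s t, [/\ c != 0, (s, t) != (0, 0) &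
                             v = c *: (veronese n s t *m B)]].

(** The restriction of [f] to the chart s = 1 of the curve, as a polynomial in t. *)
Definition pullback (f : {mpoly F[n.+1]}) : {poly F} :=
  mmap polyC (fun i => \sum_(j < n.+1) B j i *: 'X^j) f.

Definition linear_form (l : 'rV[F]_n.+1) : {mpoly F[n.+1]} :=
  \sum_i l 0 i *: 'X_i.

Lemma linear_form_homog l : linear_form l \is 1.-homog.
Proof. by apply: rpred_sum => i _; apply: rpredZ; rewrite dhomogX /= mdeg1. Qed.

Lemma meval_linear_form l v : (linear_form l).@[coords v] = (v *m l^T) 0 0.
Proof.
rewrite /linear_form raddf_sum mxE; apply: eq_bigr => i _ /=.
by rewrite mevalZ mevalXU mxE mulrC.
Qed.

Lemma horner_pullback f x :
  (pullback f).[x] = f.@[coords (veronese n 1 x *m B)].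
Proof.
rewrite horner_mmap; apply: meval_eq => i; rewrite horner_sum /coords mxE.
by apply: eq_bigr => j _; rewrite hornerZ hornerXn mxE expr1n mul1r mulrC.
Qed.

Lemma size_pullback d f : f \is d.-homog -> (size (pullback f) <= (d * n).+1)%N.
Proof.
move=> hf; apply: size_mmap_homog => // i.
apply: (leq_trans (size_sum _ _ _)); apply/bigmax_leqP => j _.
by apply: (leq_trans (size_scale_leq _ _)); rewrite size_polyXn.
Qed.

Lemma pullbackM f g : pullback (f * g) = pullback f * pullback g.
Proof. exact: rmorphM. Qed.

Lemma pullbackX f d : pullback (f ^+ d) = pullback f ^+ d.
Proof. exact: rmorphXn. Qed.

Lemma pullbackD f g : pullback (f + g) = pullback f + pullback g.
Proof. exact: rmorphD. Qed.

Lemma pullback_linear_form l : pullback (linear_form l) = rVpoly (l *m B^T).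
Proof.
rewrite /pullback /linear_form raddf_sum /=.
under eq_bigr => i _ do rewrite mmapZ mmapX mmap1U mul_polyC scaler_sumr.
rewrite exchange_big /=; apply/polyP => j; rewrite coef_rVpoly coef_sum.
case: insubP => /= [a _ <-|].
  rewrite (bigD1 a) //= [X in _ + X]big1 ?addr0 => [|b ne_ba]; last first.
    rewrite coef_sum big1 // => i _.
    by rewrite !coefZ coefXn eq_sym (inj_eq val_inj) (negbTE ne_ba) !mulr0.
  rewrite coef_sum mxE; apply: eq_bigr => i _.
  by rewrite !coefZ coefXn eqxx mulr1 mxE.
rewrite -leqNgt => le_nj; rewrite big1 // => b _; rewrite coef_sum big1 // => i _.
rewrite !coefZ coefXn; case: eqP => [jb|_]; last by rewrite !mulr0.
by have := ltn_ord b; rewrite -jb ltnNge le_nj.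
Qed.

(** As [B] is invertible, each power of X up to the [n]-th is the restriction of a linear form. A
    product of [d] of these gives the exponent [j]. *)
Lemma pullback_Xn d j : (j <= d * n)%N ->
  exists2 h : {mpoly F[n.+1]}, h \is d.-homog & pullback h = 'X^j.
Proof.
elim: d j => [|d IH] j.
  rewrite leqn0 => /eqP ->; exists 1; first exact: dhomog1.
  by rewrite expr0 [LHS]rmorph1.
move=> le_j; pose a := minn j n; have lt_a : (a < n.+1)%N by rewrite ltnS geq_minr.
have [|h hh ph] := IH (j - a)%N; first by move: le_j; rewrite /a mulSn; lia.
pose l := delta_mx 0 (Ordinal lt_a) *m invmx B^T : 'rV[F]_n.+1.
exists (linear_form l * h); first exact: (dhomogM (linear_form_homog l) hh).
rewrite pullbackM ph pullback_linear_form /l mulmxKV ?unitmx_tr //.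
rewrite rVpoly_delta -exprD subnKC //; exact: geq_minl.
Qed.

Lemma pullback_eq0 d f : f \is d.-homog -> pullback f = 0 ->
  forall v, rnc v -> f.@[coords v] = 0.
Proof.
move=> hf f0 v [c [s [t [c0 st0 ->]]]].
have scale (a : F) w : f.@[coords (a *: w)] = a ^+ d * f.@[coords w].
  by rewrite -meval_homog //; apply: meval_eq => i; rewrite /coords mxE.
rewrite scale.
have affine (s' : F) : s' != 0 -> f.@[coords (veronese n s' t *m B)] = 0.
  move=> s'0.
  have -> : veronese n s' t = s' ^+ n *: veronese n 1 (t / s').
    apply/rowP => i; rewrite !mxE expr1n mul1r expr_div_n.
    rewrite -[in X in s' ^+ X * (_ / _)](subnK (ltnSE (ltn_ord i))) exprD -mulrA.
    congr (_ * _).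
    by rewrite mulrCA mulfV ?mulr1 // expf_neq0.
  by rewrite -scalemxAl scale -horner_pullback f0 horner0 mulr0.
have [s0|/affine ->] := eqVneq s 0; last by rewrite mulr0.
(* The point at infinity of the parametrization is a limit of the others. *)
pose q := mmap polyC (fun i => \sum_(j < n.+1) (t ^+ j * B j i) *: 'X^(n - j)) f.
have qE x : q.[x] = f.@[coords (veronese n x t *m B)].
  rewrite horner_mmap; apply: meval_eq => i; rewrite horner_sum /coords mxE.
  apply: eq_bigr => j _; rewrite hornerZ hornerXn mxE.
  by rewrite mulrC mulrA.
suff -> : f.@[coords (veronese n s t *m B)] = 0 by rewrite mulr0.
rewrite s0 -qE; apply: contrapT => /eqP q0.
(* The factor ['X] makes the non-root nonzero, hence a point of the chart already treated. *)
have : 'X * q != 0.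
  by rewrite mulf_neq0 ?polyX_eq0 //; apply: contra q0 => /eqP ->; rewrite horner0.
move=> /exists_nonroot[x]; rewrite hornerM hornerX mulf_eq0 negb_or.
by move=> /andP[x0]; rewrite qE affine ?eqxx.
Qed.

(* Restricting linear forms to the curve identifies the annihilator of W with
   a space V of polynomials of degree at most n.  Let V_j be the sum of the
   X^a V for a <= j: in degree d, the quotient by the sum of the two ideals is
   that of the polynomials of degree at most dn by a space that contains V_j
   for j = (d - 1) n.  Since dim V_j increases with j, the assumption on the
   degree forces dim V_1 <= dim V + 1. *)
Lemma divisor_exists i (W : grassmannian F n i) : (i < n)%N ->
  has_finite_degree
    (ideal_sum (homogeneous_ideal rnc) (homogeneous_ideal (linear_space W))) i.+1 ->
  exists2 G : {poly F}, G != 0 & forall b, (b < n - i)%N ->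
    exists2 l : 'rV[F]_n.+1, forall w, w \in val W -> w *m l^T = 0 &
      rVpoly (l *m B^T) = G * 'X^b.
Proof.
(* The degree used is [d.+1], at least [d0]; a positive [d] leaves room for at least one
   multiplication by X. *)
move=> lt_in [d0 Hd0]; pose d := (maxn d0 2).-1.
have d1 : (0 < d)%N by rewrite /d; lia.
have {Hd0} := Hd0 d.+1 (_ : (d0 <= d.+1)%N); rewrite /hilbert_ideal.
set S := degree_part _ _ => /(_ ltac:(rewrite /d; lia)) dimS.
pose N := (d.+1 * n).+1; pose m := (d * n)%N.
have m1 : (0 < m)%N by rewrite muln_gt0 d1 (leq_ltn_trans _ lt_in).
have NE : N = (n.+1 + m)%N by rewrite /N mulSn addSn.
pose phi (p : dhomog n.+1 F d.+1) : 'rV[F]_N := poly_rV (pullback p).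
have phi_lin : linear phi.
  move=> a p q; rewrite /phi -linearP; congr (poly_rV _).
  by rewrite pullbackD /pullback mmapZ mul_polyC.
pose phiL := GRing.isLinear.Build F _ _ _ phi phi_lin.
pose phil : {linear dhomog n.+1 F d.+1 -> 'rV[F]_N} := HB.pack phi phiL.
have phiE p : rVpoly (phi p) = pullback p.
  by rewrite poly_rV_K // size_pullback // dhomog_is_dhomog.
have kerS : (lker (linfun phil) <= S)%VS.
  apply/subvP => p; rewrite memv_ker lfunE => /eqP /= phip; apply/mem_ideal_sum.
  exists (mpoly_of_dhomog p), 0; split; rewrite ?addr0 //; last exact: homogeneous_ideal0.
  apply/(homogeneous_idealE _ (dhomog_is_dhomog p)).
  apply: (pullback_eq0 (dhomog_is_dhomog p)).
  by rewrite -phiE phip linear0.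
have WS p : p \in vanishing (linear_space W) d.+1 -> p \in S.
  move=> /mem_vanishing pW; apply/mem_ideal_sum.
  exists 0, (mpoly_of_dhomog p); split; rewrite ?add0r //; first exact: homogeneous_ideal0.
  exact/(homogeneous_idealE _ (dhomog_is_dhomog p)).
(* Since [S] contains the kernel, its image has codimension i + 1 in the image of all forms, which
   has dimension at most [N]. *)
have dim_phiS : (\dim (linfun phil @: S) + i.+1 <= N)%N.
  have := limg_ker_dim (linfun phil) fullv; rewrite capfv.
  have := limg_ker_dim (linfun phil) S; rewrite (capv_idPr kerS).
  have := dimvS (subvf (limg (linfun phil))).
  rewrite [\dim {: 'rV_N}]dimvf [dim _]mul1n.
  have := dimvS (subvf S); move: dimS; rewrite /reverse_coercion; lia.
have [M MW] := row_space_exists (eqP (valP W)).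
pose ann := lker (linfun (mulmxr M^T) : 'Hom('rV[F]_n.+1, 'rV[F]_i.+1)).
have annP l : l \in ann -> forall w, w \in val W -> w *m l^T = 0.
  rewrite memv_ker lfunE /= => /eqP lM w; rewrite -MW => /row_spaceP[c ->].
  by rewrite -mulmxA -[M]trmxK -trmx_mul lM trmx0 mulmx0.
have dim_ann : (n - i <= \dim ann)%N.
  have := limg_ker_dim (linfun (mulmxr M^T) : 'Hom('rV[F]_n.+1, 'rV[F]_i.+1)) fullv.
  rewrite capfv -/ann.
  have := dimvS (subvf (limg (linfun (mulmxr M^T) : 'Hom('rV[F]_n.+1, 'rV[F]_i.+1)))).
  rewrite [\dim {: 'rV_i.+1}]dimvf [dim 'rV_i.+1]mul1n.
  rewrite [\dim {: 'rV_n.+1}]dimvf [dim 'rV_n.+1]mul1n /reverse_coercion; lia.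
pose g : 'Hom('rV[F]_n.+1, 'rV[F]_N) :=
  linfun (poly_rV \o @rVpoly F n.+1 \o mulmxr B^T).
have le_nN : (n.+1 <= N)%N by rewrite NE leq_addr.
have gE l : rVpoly (g l) = rVpoly (l *m B^T).
  by rewrite lfunE /= poly_rV_K // (leq_trans (size_poly _ _)).
pose V j := iter j (fun U => U + mulX F N @: U)%VS (g @: ann)%VS.
have VS j : V j.+1 = (V j + mulX F N @: V j)%VS by [].
have dimV0 : \dim (V 0) = \dim ann.
  apply: limg_dim_eq; apply/eqP; rewrite -subv0; apply/subvP => l.
  rewrite memv_cap memv_ker memv0 => /andP[_ /eqP gl0].
  have : l *m B^T == 0 by rewrite -[_ *m _]rVpolyK -gE gl0 !linear0.
  by rewrite -{1}(mul0mx _ B^T) (inj_eq (row_free_inj _)) // row_free_unit unitmx_tr.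
have sV j u : u \in V j -> (j <= m)%N -> (size (rVpoly u) <= n.+1 + j)%N.
  elim: j u => [|j IH] u; first by move=> /memv_imgP[l _ ->] _; rewrite gE addn0 size_poly.
  rewrite VS => /memv_addP[u1 u1V [_ /memv_imgP[u2 u2V ->] ->]] lt_jm.
  have su2 := IH _ u2V (ltnW lt_jm).
  rewrite linearD (leq_trans (size_polyD _ _)) // geq_max.
  rewrite (leq_trans (IH _ u1V (ltnW lt_jm))) ?leq_add2l //=.
  rewrite rVpoly_mulX ?(leq_ltn_trans su2) ?NE ?ltn_add2l //.
  by rewrite (leq_trans (size_polyMleq _ _)) // size_polyX addnS.
have V_lt j : (j < m)%N -> {in V j, forall u, (size (rVpoly u) < N)%N}.
  move=> lt_jm u uV; rewrite (leq_ltn_trans (sV _ _ uV (ltnW lt_jm))) //.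
  by rewrite NE ltn_add2l.
(* The exponent [a] is kept free to absorb each multiplication by X. At the bottom, X^a is the
   restriction of a form of degree [d], which multiplies a linear form vanishing on [W]. *)
have VW j u a : u \in V j -> (a + j <= m)%N ->
    exists2 p, p \in vanishing (linear_space W) d.+1 & pullback p = 'X^a * rVpoly u.
  elim: j u a => [|j IH] u a.
    move=> /memv_imgP[l lann ->]; rewrite addn0 => le_a.
    have [h hh ph] := pullback_Xn le_a.
    have hp : linear_form l * h \is d.+1.-homog := dhomogM (linear_form_homog l) hh.
    exists (DHomog hp); last by rewrite pullbackM ph pullback_linear_form gE mulrC.
    apply/mem_vanishing => v [_ vW] /=.
    by rewrite mevalM meval_linear_form (annP _ lann) // mxE mul0r.
  rewrite VS => /memv_addP[u1 u1V [_ /memv_imgP[u2 u2V ->] ->]] le_a.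
  have [|p1 p1W p1E] := IH _ a u1V; first by move: le_a; lia.
  have [|p2 p2W p2E] := IH _ a.+1 u2V; first by move: le_a; lia.
  exists (p1 + p2); first exact: memvD.
  rewrite !linearD /= pullbackD p1E p2E mulrDr.
  rewrite rVpoly_mulX ?(V_lt j) ?mulrA -?exprSr //; move: le_a; lia.
have VmS : (V m <= linfun phil @: S)%VS.
  apply/subvP => u uV; have [//|p pW pu] := VW m u 0%N uV.
  apply/memv_imgP; exists p; first exact: WS.
  by rewrite lfunE /= /phi pu expr0 mul1r rVpolyK.
have V0 j : V j != 0%VS.
  rewrite -dimv_eq0 -lt0n; elim: j => [|j IH]; last first.
    by rewrite (leq_trans IH) // VS dimvS // addvSl.
  by rewrite dimV0 (leq_trans _ dim_ann) // subn_gt0.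
have grow j : (j < m)%N -> (\dim (V 1) + j <= \dim (V j.+1))%N.
  elim: j => [|j IH] lt_jm; first by rewrite addn0.
  rewrite addnS (leq_ltn_trans (IH (ltnW lt_jm))) //.
  by rewrite (VS j.+1) dim_mulX_lt //; apply: V_lt.
(* Here dim V_1 + (m - 1) <= dim V_m <= N - (i + 1) = n + m - i, so dim V_1 <= n - i + 1, while dim
   V_0 >= n - i. *)
have dimV1 : (\dim (V 1) <= (\dim (V 0)).+1)%N.
  have := grow m.-1; rewrite prednK // leqnn => /(_ isT).
  have := dimvS VmS; move: dim_phiS; rewrite dimV0; move: dim_ann.
  by have := NE; rewrite /reverse_coercion; lia.
have [||//|G G0 HG] := @dim_mulX_eq _ _ (n - i) (V 0).
- exact: V_lt.
- by rewrite subn_gt0 lt_in dimV0.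
exists G => // b /HG[_ /memv_imgP[l lann ->] gl].
by exists l; [apply: annP|rewrite -gE].
Qed.

End RationalNormalCurve.

(** * Deformation of a linear space spanned by a divisor on the curve *)

Section Deformation.
Variables (F : closedFieldType) (n i : nat).
Hypothesis lt_in : (i < n)%N.

(** The linear forms that cut out the span of the divisor of [G], in coordinates where the curve is
    standard. The ring is general so that [G] may depend on a parameter. *)
Definition multiples (R : nzRingType) (G : {poly R}) : 'M[R]_(n - i, n.+1) :=
  \matrix_(b, l) (G * 'X^b)`_l.

Lemma size_multiple (G : {poly F}) (b : 'I_(n - i)) :
  (size G <= i.+2)%N -> (size (G * 'X^b)%R <= n.+1)%N.
Proof.
move=> sG; apply: (leq_trans (size_polyMleq _ _)); rewrite size_polyXn addnS /=.
by apply: (leq_trans (leq_add sG (leqnn _))); have := ltn_ord b; lia.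
Qed.

Lemma multiples_row_free (G : {poly F}) :
  G != 0 -> (size G <= i.+2)%N -> row_free (multiples G).
Proof.
move=> G0 sG; apply: inj_row_free => c cG.
have /eqP : G * rVpoly c = 0.
  apply/polyP => l; rewrite coef0.
  have -> : G * rVpoly c = \sum_(b < n - i) c 0 b *: (G * 'X^b).
    rewrite [c in rVpoly c]row_sum_delta linear_sum mulr_sumr.
    by apply: eq_bigr => b _; rewrite linearZ /= rVpoly_delta scalerAr.
  rewrite coef_sum; have [lt_ln|le_nl] := ltnP l n.+1.
    have := congr1 (fun u : 'rV_n.+1 => u 0 (Ordinal lt_ln)) cG; rewrite !mxE => cGl.
    by rewrite -[RHS]cGl; apply: eq_bigr => b _; rewrite coefZ mxE.
  rewrite big1 // => b _; rewrite coefZ nth_default ?mulr0 //.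
  exact: leq_trans (size_multiple b sG) le_nl.
rewrite mulf_eq0 (negbTE G0) /= => /eqP c0.
by rewrite -(rVpolyK c) c0 linear0.
Qed.

(** The binary form with zeros (s : t) = (a_j : b_j), written in the chart s = 1. *)
Definition binary_form (c : F) (a b : 'I_i.+1 -> F) : {poly F} :=
  c%:P * \prod_j ((a j)%:P * 'X - (b j)%:P).

(* The factors with leading coefficient 0 stand for the roots at infinity. *)
Lemma binary_form_exists (G : {poly F}) : G != 0 -> (size G <= i.+2)%N ->
  exists c a b, c != 0 /\ G = binary_form c a b.
Proof.
move=> G0 sG; have [r Gr] := closed_field_poly_normal G.
have c0 : lead_coef G != 0 by rewrite lead_coef_eq0.
have sr : (size r <= i.+1)%N.
  by move: sG; rewrite Gr size_scale // size_prod_XsubC ltnS.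
(* Beyond the roots of [G], the values 0 and -1 make the factor equal to 1. *)
exists (lead_coef G), (fun j => (j < size r)%:R),
  (fun j => if (j < size r)%N then r`_j else -1).
split=> //; rewrite {1}Gr /binary_form mul_polyC; congr (_ *: _).
rewrite (big_nth 0) -(big_mkord xpredT (fun j => (j < size r)%:R%:P * 'X -
   (if (j < size r)%N then r`_j else -1)%:P)).
rewrite [RHS](big_cat_nat (n := size r)) //= [X in _ * X]big_nat [X in _ * X]big1 ?mulr1.
  by apply: eq_big_nat => j /andP[_ ->]; rewrite mul1r.
move=> j /andP[le_j _]; rewrite ltnNge le_j /= mul0r sub0r.
by rewrite polyCN opprK.
Qed.

Lemma size_binary_form c a b : (size (binary_form c a b) <= i.+2)%N.
Proof.
rewrite /binary_form mul_polyC; apply: (leq_trans (size_scale_leq _ _)).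
apply: (leq_trans (size_prod_leq _ _)) => /=.
have card_i : #|(fun _ : 'I_i.+1 => true)| = i.+1 by rewrite -[RHS]card_ord.
rewrite leq_subLR card_i addnS ltnS.
apply: (@leq_trans (\sum_(j < i.+1) 2)); last first.
  by rewrite sum_nat_const card_i muln2 -addnn.
apply: leq_sum => j _; rewrite (leq_trans (size_polyD _ _)) // geq_max size_polyN.
rewrite mul_polyC (leq_trans (size_scale_leq _ _)) ?size_polyX //=.
by rewrite (leq_trans (size_polyC_leq1 _)).
Qed.

Lemma binary_form_neq0 c a b :
  c != 0 -> (forall j, a j != 0) -> binary_form c a b != 0.
Proof.
move=> c0 a0; rewrite mulf_neq0 ?polyC_eq0 //; apply/prodf_neq0 => j _.
apply/eqP => /(congr1 (fun p : {poly F} => p`_1)); rewrite coef0 coefB coefC subr0.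
by rewrite coefMX coefC /= => /eqP; rewrite (negbTE (a0 j)).
Qed.

Lemma root_binary_form c a b j : a j != 0 -> (binary_form c a b).[b j / a j] = 0.
Proof.
move=> a0; rewrite hornerM horner_prod (bigD1 j) //=.
rewrite hornerD hornerN hornerM !hornerC hornerX.
by rewrite [a j * _]mulrCA mulfV // mulr1 subrr mul0r mulr0.
Qed.

(* A basis M of W is moved along with the divisor cut out by W on the curve,
   whose points (a_j : b_j) move to (a_j + x : b_j + x d_j). *)
Lemma deformation (B : 'M[F]_n.+1) (M : 'M[F]_(i.+1, n.+1)) (G : {poly F})
    (d : 'I_i.+1 -> F) :
  B \in unitmx -> G != 0 ->
  (forall b, (b < n - i)%N -> exists2 l : 'rV[F]_n.+1,
     M *m l^T = 0 & rVpoly (l *m B^T) = G * 'X^b) ->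
  exists (a b : 'I_i.+1 -> F) (T : 'M[{poly F}]_(i.+1, n.+1)),
    mx_at 0 T = M /\ forall x, (forall j, a j + x != 0) -> row_free (mx_at x T) ->
      forall j, veronese n 1 ((b j + x * d j) / (a j + x)) *m B
                  \in row_space (mx_at x T).
Proof.
move=> B_unit G0 HG.
(* The largest multiple, by X^(n - i - 1), still has degree at most [n]. *)
have sG : (size G <= i.+2)%N.
  have lt_b : ((n - i).-1 < n - i)%N by lia.
  have [l _ lG] := HG _ lt_b.
  have := size_poly n.+1 (fun k => if insub k is Some j then (l *m B^T) 0 j else 0).
  rewrite -[\poly_(_ < _) _]/(rVpoly (l *m B^T)) lG size_mulXn //; lia.
have [c [a [b [c0 GE]]]] := binary_form_exists G0 sG.
(* The outer variable is the coordinate on the curve, the inner one the parameter of the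
   deformation. *)
pose Gt : {poly {poly F}} :=
  c%:P%:P * \prod_j (((a j)%:P + 'X)%:P * 'X - ((b j)%:P + 'X * (d j)%:P)%:P).
have GtE x : map_poly (horner_eval x) Gt =
    binary_form c (fun j => a j + x) (fun j => b j + x * d j).
  rewrite rmorphM rmorph_prod; congr (_ * _).
    by rewrite [LHS]map_polyC /= /horner_eval hornerC.
  apply: eq_bigr => j _.
  rewrite rmorphB rmorphM; congr (_ * _ - _);
    last by rewrite [LHS]map_polyC /= /horner_eval !hornerE.
    by rewrite [LHS]map_polyC /= /horner_eval !hornerE.
  exact: map_polyX.
have TE x : mx_at x (multiples Gt) =
    multiples (binary_form c (fun j => a j + x) (fun j => b j + x * d j)).
  apply/matrixP => k l; rewrite !mxE -GtE -coef_map rmorphM /=.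
  by rewrite map_polyXn.
have T0 : mx_at 0 (multiples Gt) = multiples G.
  rewrite TE GE; congr (multiples (_ * _)); apply: eq_bigr => j _.
  by rewrite mul0r !addr0.
have [||Y TY Y0] := @kernel_path _ _ _ _ (multiples Gt) (M *m invmx B)^T.
- by rewrite T0 multiples_row_free.
- rewrite T0; apply/row_matrixP => k; rewrite row_mul row0.
  have [l Ml lG] := HG k (ltn_ord k).
  have -> : row k (multiples G) = l *m B^T.
    apply/rowP => j; rewrite !mxE -lG coef_rVpoly.
    by case: insubP => /= [j' _ /val_inj ->|]; rewrite ?mxE // ltn_ord.
  by rewrite -mulmxA -trmx_mul mulmxKV // -[l]trmxK -trmx_mul Ml trmx0.
exists a, b, (Y^T *m map_mx polyC B).
have TxE x : mx_at x (Y^T *m map_mx polyC B) = (mx_at x Y)^T *m B.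
  rewrite /mx_at map_mxM map_trmx; congr (_ *m _).
  by apply/matrixP => k l; rewrite !mxE; apply: hornerC.
split=> [|x ax0]; first by rewrite TxE Y0 trmxK mulmxKV.
rewrite TxE => freeT j; set K := multiples (binary_form c (fun j => a j + x)
  (fun j => b j + x * d j)).
(* The rows of Y(x)^T are independent and annihilated by [K], so they span its whole kernel by
   dimension. The points of the divisor lie in this kernel. *)
have rankK : \rank (kermx K^T) = i.+1.
  rewrite mxrank_ker mxrank_tr (eqP (_ : row_free K)); first by lia.
  by rewrite multiples_row_free ?binary_form_neq0 ?size_binary_form.
have YK : ((mx_at x Y)^T <= kermx K^T)%MS.
  apply/sub_kermxP; rewrite -trmx_mul /K -TE -map_mxM.
  by rewrite TY map_mx0 trmx0.
have KY : (kermx K^T <= (mx_at x Y)^T)%MS.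
  rewrite -(geq_leqif (mxrank_leqif_sup YK)) rankK.
  by rewrite -(mxrankMfree _ (_ : row_free B)) ?row_free_unit // (eqP freeT).
have /submxP[u uE] : (veronese n 1 ((b j + x * d j) / (a j + x)) <= (mx_at x Y)^T)%MS.
  apply: submx_trans KY; apply/sub_kermxP/rowP => k; rewrite !mxE.
  set t := _ / _.
  have := @root_binary_form c (fun j => a j + x) (fun j => b j + x * d j) j (ax0 j).
  rewrite -/t => Gt0; transitivity ((binary_form c (fun j => a j + x)
    (fun j => b j + x * d j) * 'X^k).[t]); last by rewrite hornerM Gt0 mul0r.
  rewrite (@horner_coef_wide _ n.+1) ?size_multiple ?size_binary_form //.
  by apply: eq_bigr => l _; rewrite !mxE expr1n mul1r mulrC.
by rewrite uE -mulmxA; apply/row_spaceP; exists u.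
Qed.

End Deformation.

(** * Generic values of the Hilbert function *)

(** A configuration [A0] in [U] maximizes the sum of the values in degrees 1 to [D]. Where no value
    is smaller than at [A0], an open condition, maximality of the sum forces equality. Finitely many
    degrees keep the intersection open. *)
Lemma generic_hilbert (F : fieldType) (n : nat) (I : finType) (e : I -> nat)
    (U : set (grassmannian_product F n e)) (Q : I -> Prop) (D : nat) :
  zariski_open U -> U !=set0 ->
  exists V, [/\ zariski_open V, V !=set0, V `<=` U &
    forall A B, V A -> V B -> forall d, (d < D)%N ->
      hilbert (union_on Q A) d.+1 = hilbert (union_on Q B) d.+1].
Proof.
move=> openU [A1 UA1]; pose h A d := hilbert (@union_on F n I e Q A) d.+1.
pose total A := (\sum_(d < D) h A d)%N.
pose P m := `[< exists2 A, U A & total A = m >].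
have exP : exists m, P m by exists (total A1); apply/asboolP; exists A1.
have ubP m : P m -> (m <= \sum_(d < D) \dim {: dhomog n.+1 F d.+1})%N.
  move=> /asboolP[A _ <-]; apply: leq_sum => d _.
  by rewrite -(dim_vanishing_hilbert (union_on Q A)) leq_addl.
have [m /asboolP[A0 UA0 <-] maxm] := ex_maxnP exP ubP.
pose V := U `&` [set A | forall d, (d < D)%N -> (h A0 d <= h A d)%N].
have VE A d : V A -> (d < D)%N -> h A d = h A0 d.
  move=> [UA hA] lt_dD; apply/eqP; rewrite eqn_leq hA // andbT leqNgt.
  apply/negP => lt_h; have : P (total A) by apply/asboolP; exists A.
  move=> /maxm; apply/negP; rewrite -ltnNge /total.
  rewrite (bigD1 (Ordinal lt_dD)) //= [ltnRHS](bigD1 (Ordinal lt_dD)) //=.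
  by rewrite -addSn leq_add // leq_sum // => c _; apply: hA.
exists V; split.
- apply: zariski_openI => //.
  by apply: zariski_open_bigcap => d; apply: hilbert_open.
- by exists A0; split.
- by move=> A [].
- by move=> A B VA VB d lt_dD; rewrite -!/(h _ _) !VE.
Qed.

(** * Contradiction for a configuration with distinct points on the curve *)

Section Contradiction.
Variables (F : numClosedFieldType) (n : nat) (J : finType) (e : J -> nat).
Variable y0 : J.
Hypothesis lt_en : forall y, (e y < n)%N.
Implicit Types (A : grassmannian_product F n e).

Definition others A := union_on (fun y => y <> y0) A.

Lemma union_others A : others A `|` linear_space (A y0) = union_on (fun=> True) A.
Proof.
apply/seteqP; split=> v.
  by move=> [[y [_ Av]]|Av]; [exists y | exists y0].
move=> [y [_ Av]]; have [yy0|ne] := eqVneq y y0.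
  by right; rewrite -yy0.
by left; exists y; split=> //; apply/eqP.
Qed.

Lemma nonzero_point A y : exists v, linear_space (A y) v.
Proof.
exists (vpick (val (A y))); split; last exact: memv_pick.
by rewrite vpick0 -dimv_eq0 (eqP (valP (A y))).
Qed.

(** The constant 1 would be a sum of two constants, each vanishing on a non-empty set. *)
Lemma no_split_degree0 A y : y <> y0 ->
  ~ (hilbert (others A) 0 + 'C(0 + e y0, e y0) <=
       hilbert (others A `|` linear_space (A y0)) 0)%N.
Proof.
move=> yy0 /split_form/(_ (DHomog (dhomog1 _ _))).
move=> [f [g [/mem_vanishing f0 /mem_vanishing g0]]].
move=> /(congr1 (@mpoly_of_dhomog _ _ _)) /= E.
have const w : (mpoly_of_dhomog f).@[coords w] = (mpoly_of_dhomog f).@[fun=> 0].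
  rewrite -[LHS]mul1r -[1](expr0 0) -(meval_homog _ _ (dhomog_is_dhomog f)).
  by apply: meval_eq => i; rewrite mul0r.
have [v Av] := nonzero_point A y; have [w Aw] := nonzero_point A y0.
have := congr1 (meval (coords w)) E; rewrite meval1 mevalD g0 // addr0 const.
by rewrite -(const v) f0; [move/eqP; rewrite oner_eq0 | exists y].
Qed.

(* The form l vanishes at all the given points of the curve on A y0, but one.
   If l^d agrees on A y0 with a form f vanishing on the other spaces, then f
   vanishes at too many points of the curve. *)
Lemma no_split_on_curve A d (B : 'M[F]_n.+1) (t : {y : J & 'I_(e y).+1} -> F) :
  B \in unitmx -> injective t -> (0 < d)%N ->
  (forall p, veronese n 1 (t p) *m B \in val (A (tag p))) ->
  (d * n < \sum_y (e y).+1 - 1)%N ->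
  ~ (hilbert (others A) d + 'C(d + e y0, e y0) <=
       hilbert (others A `|` linear_space (A y0)) d)%N.
Proof.
move=> B_unit t_inj d_gt0 At lt_dn /split_form split_A.
pose pt (j : 'I_(e y0).+1) : {y : J & 'I_(e y).+1} := Tagged (fun y => 'I_(e y).+1) j.
have pt_inj : injective pt := @eq_from_Tagged _ _ _.
(* The factors run over the points on [A y0] except that of index 0, which is not a root because [t]
   is injective. *)
pose q : {poly F} := \prod_(j < e y0) ('X - (t (pt (lift ord0 j)))%:P).
have sq : (size q <= n.+1)%N.
  by rewrite size_prod_XsubC [index_enum _]unlock -enumT size_enum_ord ltnS ltnW.
pose l := poly_rV q *m invmx B^T : 'rV[F]_n.+1.
have lq : pullback B (linear_form l) = q.
  by rewrite pullback_linear_form mulmxKV ?unitmx_tr // poly_rV_K.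
have hl : linear_form l ^+ d \is d.-homog.
  by rewrite -[X in X.-homog]mul1n; apply/dhomogMn/linear_form_homog.
have [f [g [/mem_vanishing fX /mem_vanishing gY]]] := split_A (DHomog hl).
move=> /(congr1 (@mpoly_of_dhomog _ _ _)) /= fgE.
have space p : linear_space (A (tag p)) (veronese n 1 (t p) *m B).
  split; last exact: At.
  rewrite -(inj_eq (row_free_inj (_ : row_free (invmx B)))) ?row_free_unit ?unitmx_inv //.
  rewrite mulmxK // mul0mx; apply/eqP => /rowP/(_ ord0)/eqP.
  by rewrite !mxE !expr1n expr0 mulr1 oner_eq0.
have fy0 j : (pullback B f).[t (pt j)] = q.[t (pt j)] ^+ d.
  have := congr1 (fun p => (pullback B p).[t (pt j)]) fgE.
  rewrite /= pullbackX lq horner_exp pullbackD hornerD => ->.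
  by rewrite [X in _ + X]horner_pullback gY ?addr0 //; apply: (space (pt j)).
pose p0 := pt ord0.
have roots p : p != p0 -> root (pullback B f) (t p).
  rewrite rootE => pp0; have [py0|/eqP py0] := eqVneq (tag p) y0; last first.
    by rewrite horner_pullback fX //; exists (tag p).
  case: p py0 pp0 => y j /= yy0; subst y; have -> : existT _ y0 j = pt j by [].
  rewrite fy0 (inj_eq pt_inj) => j0.
  have [i ->|] := unliftP ord0 j; last by move=> jE; rewrite jE eqxx in j0.
  by rewrite /q horner_prod (bigD1 i) //= hornerXsubC subrr mul0r expr0n eqn0Ngt d_gt0.
have : pullback B f = 0.
  apply: contraTeq lt_dn => f0; rewrite -leqNgt.
  pose s := [seq t p | p <- enum (predC1 p0)].
  have roots_s : all (root (pullback B f)) s.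
    by apply/allP => x /mapP[p]; rewrite mem_enum => /roots rp ->.
  have uniq_s : uniq s by rewrite map_inj_uniq ?enum_uniq.
  have lt_s := max_poly_roots f0 roots_s uniq_s.
  have := leq_trans lt_s (size_pullback B (dhomog_is_dhomog f)).
  rewrite ltnS size_map -cardE cardC1 card_tagged sumnE big_map big_enum /=.
  by under eq_bigr do rewrite card_ord; rewrite subn1.
move=> f0; have := fy0 ord0; rewrite f0 horner0 => /esym/eqP.
rewrite expf_eq0 d_gt0 /= /q horner_prod; apply/negP/prodf_neq0 => j _.
by rewrite hornerXsubC subr_eq0 (inj_eq t_inj) (inj_eq pt_inj).
Qed.

End Contradiction.

(** * Passage from a feasible configuration to distinct points *)

Section GenericConfigurations.
Variables (F : numClosedFieldType) (n : nat) (J : finType) (e : J -> nat).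
Variable y0 : J.
Hypothesis lt_en : forall y, (e y < n)%N.
Implicit Types (A : grassmannian_product F n e).

(* The points of the deformed spaces on the curve are pairwise distinct for
   general x: for x large, (a_p + x : b_p + x d_p) is close to (1 : d_p). *)
Lemma distinct_path (P : finType) (a b d : P -> F) : injective d ->
  exists2 q : {poly F}, q != 0 & forall x, q.[x] != 0 ->
    (forall p, a p + x != 0) /\ injective (fun p => (b p + x * d p) / (a p + x)).
Proof.
move=> d_inj.
pose num p : {poly F} := (b p)%:P + 'X * (d p)%:P.
pose den p : {poly F} := (a p)%:P + 'X.
pose r (z : P * P) : {poly F} := num z.1 * den z.2 - num z.2 * den z.1.
exists ((\prod_p den p) * \prod_(z | z.1 != z.2) r z).
  apply: mulf_neq0; apply/prodf_neq0; first move=> p _.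
    apply/eqP => /(congr1 (fun p : {poly F} => p`_1)).
    by rewrite coefD coefC coefX add0r coef0 => /eqP; rewrite oner_eq0.
  move=> [p p'] /= pp'.
  (* The coefficient of degree 2 is d_p - d_p', nonzero by injectivity of [d]. *)
  apply/eqP => /(congr1 (fun p : {poly F} => p`_2)); rewrite coef0 coefB.
  have coef2 u v : (num u * den v)`_2 = d u.
    rewrite coefM !big_ord_recr big_ord0 /= !coefD !coefC !coefMC !coefX /=.
    by rewrite !(mulr0, mul0r, add0r, addr0, mul1r, mulr1).
  by rewrite !coef2 => /eqP; rewrite subr_eq0 (inj_eq d_inj) (negbTE pp').
move=> x; rewrite hornerM mulf_eq0 negb_or !horner_prod => /andP[].
move=> /prodf_neq0 den0 /prodf_neq0 r0.
have a0 p : a p + x != 0 by have := den0 p isT; rewrite !hornerE.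
split=> // p p' /eqP; rewrite eqr_div // => E.
apply: contraTeq E => pp'; have := r0 (p, p') pp'.
by rewrite /= !hornerE /= subr_eq0.
Qed.

(** All spaces are deformed with one common parameter, every point of every divisor having its own
    speed. The roots of [q] include the parameters where a space degenerates or where points collide
    or lie at infinity. *)
Lemma feasible_path A (M : forall y, 'M[F]_((e y).+1, n.+1)) :
  represents M A -> feasible_configuration A ->
  exists (T : forall y, 'M[{poly F}]_((e y).+1, n.+1)) (B : 'M[F]_n.+1)
      (q : {poly F}),
    [/\ B \in unitmx, q != 0, forall y, mx_at 0 (T y) = M y & forall x, q.[x] != 0 ->
      (forall y, row_free (mx_at x (T y))) /\
      exists2 t : {y : J & 'I_(e y).+1} -> F, injective t &
        forall p, veronese n 1 (t p) *m B \in row_space (mx_at x (T (tag p)))].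
Proof.
move=> MA [C [B B_unit ->] degA].
pose tagJ y (j : 'I_(e y).+1) : {y : J & 'I_(e y).+1} :=
  Tagged (fun y => 'I_(e y).+1) j.
pose speed (p : {y : J & 'I_(e y).+1}) : F := (enum_rank p)%:R.
have speed_inj : injective speed.
  by move=> p p' /eqP; rewrite eqr_nat => /eqP /val_inj /enum_rank_inj.
have def_y y : exists D : ('I_(e y).+1 -> F) * ('I_(e y).+1 -> F) *
      'M[{poly F}]_((e y).+1, n.+1),
    mx_at 0 D.2 = M y /\ forall x, (forall j, D.1.1 j + x != 0) ->
      row_free (mx_at x D.2) -> forall j,
      veronese n 1 ((D.1.2 j + x * speed (tagJ y j)) / (D.1.1 j + x)) *m B
        \in row_space (mx_at x D.2).
  have [G G0 HG] := divisor_exists B_unit (lt_en y) (degA y).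
  have [|a [b [T [T0 HT]]]] := @deformation _ _ _ (lt_en y) B (M y) G
      (fun j => speed (tagJ y j)) B_unit G0.
    move=> b /HG[l Al lG]; exists l => //; apply/row_matrixP => j.
    rewrite row_mul row0 Al // -MA rowE; apply/row_spaceP.
    by exists (delta_mx 0 j).
  by exists (a, b, T).
pose D y := projT1 (cid (def_y y)); have DP y := projT2 (cid (def_y y)).
have M_free y : row_free (mx_at 0 (D y).2).
  by have [-> _] := DP y; rewrite -dim_row_space MA; exact: valP (A y).
have /choice[u uP] y : exists u : {poly F}, u.[0] != 0 /\
    forall x, u.[x] != 0 -> row_free (mx_at x (D y).2).
  by have [u u0 uP] := row_free_path (M_free y); exists u.
have [v v0 vP] := distinct_path (fun p => (D (tag p)).1.1 (tagged p))
   (fun p => (D (tag p)).1.2 (tagged p)) speed_inj.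
exists (fun y => (D y).2), B, ((\prod_y u y) * v); split=> //.
- rewrite mulf_neq0 //; apply/prodf_neq0 => y _; have [+ _] := uP y.
  by apply: contraNneq => ->; rewrite horner0.
- by move=> y; case: (DP y).
move=> x; rewrite hornerM mulf_eq0 negb_or horner_prod => /andP[/prodf_neq0 ux vx].
have freeD y : row_free (mx_at x (D y).2) by have [_] := uP y; apply; apply: ux.
split=> //; have [a0 t_inj] := vP x vx; exists (fun p =>
  ((D (tag p)).1.2 (tagged p) + x * speed p) / ((D (tag p)).1.1 (tagged p) + x)) => //.
move=> [y j]; have [_ HD] := DP y.
exact: (HD x (fun j => a0 (tagJ y j)) (freeD y) j).
Qed.

Theorem generic_no_split :
  holds_generically (@feasible_configuration F n J e) ->
  holds_generically (fun A => forall d, (0 < d)%N \/ (exists y, y <> y0) ->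
    hilbert (others y0 A `|` linear_space (A y0)) d =
      (hilbert (others y0 A) d + 'C(d + e y0, e y0))%N ->
    (d * n < \sum_y (e y).+1 - 1)%N -> False).
Proof.
move=> [U0 [openU0 neU0 U0P]].
(* As [n] is positive, the assumed inequality bounds the relevant degrees by this sum. *)
have [U [openU neU UU0 constU]] :=
  generic_hilbert (fun y => y <> y0) (\sum_y (e y).+1) openU0 neU0.
exists U; split=> // A UA [|d] d_gt0 HA lt_dn.
  by case: d_gt0 => // -[y yy0]; apply: (no_split_degree0 (A := A) yy0); rewrite HA.
have [M MA] := represents_exists A.
have [T [B [q [B_unit q0 T0 HT]]]] := feasible_path MA (U0P _ (UU0 _ UA)).
pose r := hilbert (union_on (fun=> True) A) d.+1.
(* Membership in [U] fixes the Hilbert function of the other components; the second condition keeps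
   that of the union from dropping. *)
have openV := zariski_openI openU (@hilbert_open _ _ _ e (fun=> True) d r).
have [||p p0 pP] := zariski_open_path (M := T) (A := A) openV.
- by split=> //=.
- by move=> y; rewrite T0 MA.
have /exists_nonroot[x] : p * q != 0.
  by rewrite mulf_neq0 //; apply: contraNneq p0 => ->; rewrite horner0.
rewrite hornerM mulf_eq0 negb_or => /andP[px qx].
have [freeT [t t_inj tP]] := HT x qx.
have dimT y : \dim (row_space (mx_at x (T y))) == (e y).+1 by rewrite dim_row_space.
pose A' y : grassmannian F n (e y) := exist _ (row_space (mx_at x (T y))) (dimT y).
have [UA' leA'] := pP x px A' (fun y => erefl).
apply: (@no_split_on_curve F n J e y0 lt_en A' d.+1 B t) => //.
rewrite /others (constU A' A) //; last first.
  have n_gt0 : (0 < n)%N := leq_ltn_trans (leq0n _) (lt_en y0).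
  apply: leq_trans (leq_subr 1 _).
  by apply: leq_trans lt_dn; rewrite ltnS (leq_trans _ (leq_pmulr _ n_gt0)).
by rewrite -HA !union_others.
Qed.

End GenericConfigurations.

(** * Adding a component to a weight vector *)

Section WeightVectors.
Variables (n : nat) (L' : weight n) (k : 'I_n.-1).
Notation L := (add_component L' k).

Lemma le_add_component i : (L' i <= L i)%N.
Proof. exact: leq_addr. Qed.

Lemma lt_last_component : (L' k < L k)%N.
Proof. by rewrite /add_component eqxx addn1. Qed.

Definition add_index (o : option (component L')) : component L :=
  match o with
  | Some x =>
      Tagged (fun i => 'I_(L i)) (widen_ord (le_add_component (tag x)) (tagged x))
  | None => Tagged (fun i => 'I_(L i)) (Ordinal lt_last_component)
  end.

Lemma component_dim_add_index o : dims_with k o = component_dim (add_index o).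
Proof. by case: o. Qed.

Lemma add_index_bij : bijective add_index.
Proof.
(* Forgetting the dependent type lets an equality of indices be split into its two parts. *)
pose nat_index (y : component L) : 'I_n.-1 * nat := (tag y, nat_of_ord (tagged y)).
apply: inj_card_bij.
  move=> [[i j]|] [[i' j']|] // /(congr1 nat_index) //= [].
  - by move=> ii'; subst i' => jj'; congr Some; congr existT; apply: val_inj.
  - by move=> ik; subst i => jE; have := ltn_ord j; rewrite jE ltnn.
  - by move=> ik; subst i' => jE; have := ltn_ord j'; rewrite -jE ltnn.
rewrite card_option !card_tagged !sumnE !big_map -!enumT !big_enum /=.
under eq_bigr do rewrite card_ord.
under [X in (_ <= X.+1)%N]eq_bigr do rewrite card_ord.
rewrite big_split /= -[X in (_ <= X)%N]addn1 leq_add2l (bigD1 k) //= eqxx big1 //.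
by move=> i /negbTE ->.
Qed.

Lemma sum_component_dim :
  (\sum_(y : component L) (component_dim y).+1 = \sum_(i < n.-1) L i * i.+1)%N.
Proof.
pose f i (j : 'I_(L i)) := (i : nat).+1.
transitivity (\sum_(y : component L) f (tag y) (tagged y))%N; first by [].
rewrite -(@sig_big_dep _ _ _ _ _ xpredT (fun i j => true) f) /=.
by apply: eq_bigr => i _; rewrite sum_nat_const card_ord.
Qed.

End WeightVectors.

Lemma grassmannian_inhabited (F : fieldType) (n i : nat) :
  (i <= n)%N -> exists W : {vspace 'rV[F]_n.+1}, \dim W == i.+1.
Proof.
move=> le_in; exists (row_space (pid_mx i.+1 : 'M[F]_(i.+1, n.+1))).
by rewrite dim_row_space /row_free rank_pid_mx.
Qed.

(** Genericity is that of the pair of Lambda' and Gamma, taken as one family indexed by an option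
    type. In degree 0 with Lambda' empty, the equality always holds as 1 = 0 + 1, which is why that
    case is set apart. *)
Theorem proposition4p4 (R : realType) (n : nat) (n_ge2 : (2 <= n)%N)
    (L' : weight n) (k : 'I_n.-1) :
  let L := add_component L' k in
  holds_generically
    (fun A : grassmannian_product R[i] n (@dims_with n L' k) =>
       let Lambda' : grassmannian_product R[i] n (@component_dim n L') :=
         fun x => A (Some x) in
       let Gamma : grassmannian R[i] n k := A None in
       let X' := configuration_union Lambda' in
       let X := X' `|` linear_space Gamma in
       forall d : nat,
         (0 < d)%N \/ (exists i, L' i != 0%N) ->
         hilbert X d = (hilbert X' d + 'C(d + k, k))%N ->
         (\sum_(i < n.-1) L i * i.+1 - 1 > d * n)%N ->
         ~ feasible R[i] L).
Proof.
move=> L.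
have lt_ord_n (i : 'I_n.-1) : (i < n)%N.
  by apply: leq_trans (ltn_ord i) _; apply: leq_pred.
(* If [L] is not feasible, only the non-emptiness of the product of Grassmannians remains. *)
have [feasL|infeasL] := pselect (feasible R[i] L); last first.
  exists setT; split; [exact: zariski_openT | | by []].
  have inh o : exists W : {vspace 'rV[R[i]]_n.+1}, \dim W == (@dims_with n L' k o).+1.
    by apply: grassmannian_inhabited; apply: ltnW; case: o => [x|] /=; apply: lt_ord_n.
  by exists (fun o => exist _ (projT1 (cid (inh o))) (projT2 (cid (inh o)))).
have [psi indexK psiK] := add_index_bij L' k.
have lt_dim (y : component L) : (component_dim y < n)%N by apply: lt_ord_n.
apply: (reindex_holds_generically indexK psiK (@component_dim_add_index n L' k) _
  (@generic_no_split _ n _ _ (add_index k None) lt_dim feasL)).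
move=> A B AB PB /= d d_gt0 HA lt_dn _.
have linE o : linear_space (A o) = linear_space (B (add_index k o)).
  by rewrite /linear_space AB.
have unionE : configuration_union (fun x => A (Some x)) = others (add_index k None) B.
  apply/seteqP; split=> v.
    move=> [x Ax]; exists (add_index k (Some x)); split; last by rewrite -linE.
    by move/(can_inj indexK).
  move=> [y [+ By]]; rewrite -[y]psiK; case E: (psi y) => [x|] // _.
  by exists x; rewrite linE -E psiK.
apply: (PB d).
- case: d_gt0 => [|[i L'i]]; [by left | right].
  have j : 'I_(L' i) by apply: (@Ordinal _ 0); rewrite lt0n.
  exists (add_index k (Some (Tagged (fun i => 'I_(L' i)) j))).
  by move/(can_inj indexK).
- by rewrite -unionE -linE.
- by rewrite sum_component_dim.
Qed.
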